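(* Let $X$ be a finite set, let $S$ be a finite set with $|S| = 2^l$, and let $F$ be a two-universal family of functions $f: X \to S$ with $|F| = 2^{\alpha}$. Let $P_{F_R}$ be a probability distribution on $F$ satisfying $H_{\min}(P_{F_R}) \ge \beta$, i.e. $P_{F_R}(f) \le 2^{-\beta}$ for every $f \in F$; a function $f_r$ is selected according to $P_{F_R}$ (through a random seed $R \in \{0,1\}^{\alpha}$). Let $\rho_{XE} = \sum_{x \in X} |x\rangle\langle x|_X \otimes \rho_E^{[x]}$ be a classical-quantum state. For each $f \in F$, let $\rho^{[f]}_{SE} = \sum_{s \in S} |s\rangle\langle s|_S \otimes \rho_E^{[f,s]}$ with $\rho_E^{[f,s]} = \sum_{x: f(x)=s} \rho_E^{[x]}$. Then for every $\varepsilon \ge 0$, $$\Delta := \sum_{f \in F} P_{F_R}(f)\, D_u(S|E)_{\rho^{[f]}} \le \frac{1}{2}\cdot 2^{\alpha-\beta}\cdot 2^{-\frac{1}{2}\left(H_{\min}^{\varepsilon}(X|E)_{\rho} - l\right)} + \varepsilon .$$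
   Context: A family $F$ of functions $X \to S$ is two-universal if for all $x \neq x'$ in $X$, $\Pr_{f}[f(x) = f(x')] \le 1/|S|$ when $f$ is chosen uniformly from $F$. For a distribution $P$, $H_{\min}(P) = -\log_2 \max_f P(f)$. For a cq-state $\rho_{SE}$, the distance from uniform is $D_u(S|E)_\rho = \min_{\sigma_E} \frac{1}{2}\left\| \rho_{SE} - \omega_S \otimes \sigma_E \right\|_1$, where $\omega_S = 2^{-l}\mathbb{1}_S$ is the maximally mixed state on $S$ and the minimum is over states $\sigma_E$. The conditional min-entropy is $H_{\min}(X|E)_\rho = \max_{\sigma_E} \sup\{\lambda \in \mathbb{R} : \rho_{XE} \le 2^{-\lambda}\mathbb{1}_X \otimes \sigma_E\}$, and the smooth min-entropy $H_{\min}^{\varepsilon}(X|E)_\rho$ is the maximum of $H_{\min}(X|E)_{\tilde\rho}$ over sub-normalized states $\tilde\rho_{XE}$ within purified distance $\varepsilon$ of $\rho_{XE}$. $E$ denotes the eavesdropper's quantum side information. *)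

(* Defs.v *)
From HB Require Import structures.
From mathcomp Require Import all_boot all_order all_algebra.
From mathcomp Require Import sesquilinear spectral.
From mathcomp Require Import complex mxtens.
From mathcomp Require Import all_classical all_reals.
From mathcomp Require Import ereal exp.

Set Implicit Arguments.
Unset Strict Implicit.
Unset Printing Implicit Defensive.

Import Order.TTheory GRing.Theory Num.Theory.
Local Open Scope ring_scope.
Local Open Scope classical_set_scope.

Section QuantumInfo.
Variable R : realType.
Local Notation C := (R[i]).

Definition toC (x : R) : C := Complex x 0.

Definition adjmx m n (A : 'M[C]_(m, n)) : 'M[C]_(n, m) := (map_mx Num.conj A)^T.

Definition psdmx n (A : 'M[C]_n) : Prop :=
  forall v : 'rV[C]_n, 0 <= (v *m A *m adjmx v) 0 0.

Definition lemx n (A B : 'M[C]_n) : Prop := psdmx (B - A).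

Definition trR n (A : 'M[C]_n) : R := complex.Re (\tr A).

Definition is_state n (A : 'M[C]_n) : Prop := psdmx A /\ \tr A = 1.
Definition is_substate n (A : 'M[C]_n) : Prop := psdmx A /\ trR A <= 1.

(* trace norm: sum of the singular values of A, i.e. of the square roots of
   the eigenvalues of A^* A (obtained from its spectral decomposition) *)
Definition trnorm n (A : 'M[C]_n) : R :=
  complex.Re (\sum_(i < n) sqrtC (spectral_diag (adjmx A *m A) 0 i)).

(* square root of a (positive semidefinite) matrix via its spectral
   decomposition A = P^-1 diag(d) P *)
Definition sqrtm n (A : 'M[C]_n) : 'M[C]_n :=
  invmx (spectralmx A) *m diag_mx (map_mx sqrtC (spectral_diag A))
        *m spectralmx A.

Definition gen_fidelity n (A B : 'M[C]_n) : R :=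
  trnorm (sqrtm A *m sqrtm B) + Num.sqrt ((1 - trR A) * (1 - trR B)).
Definition purified_dist n (A B : 'M[C]_n) : R :=
  Num.sqrt (1 - gen_fidelity A B ^+ 2).

Definition hmin nX dE (rho : 'M[C]_(nX * dE)) : \bar R :=
  ereal_sup [set lam%:E | lam in
    [set lam : R | exists sigma : 'M[C]_dE, is_state sigma /\
        lemx rho (toC (2 `^ (- lam)) *: ((1%:M : 'M[C]_nX) *t sigma))]].

Definition hmin_smooth nX dE (eps : R) (rho : 'M[C]_(nX * dE)) : \bar R :=
  ereal_sup [set hmin rt | rt in
    [set rt : 'M[C]_(nX * dE) | is_substate rt /\ purified_dist rho rt <= eps]].

Definition dist_unif nS dE (l : R) (rho : 'M[C]_(nS * dE)) : R :=
  inf [set trnorm (rho - (toC (2 `^ (- l)) *: (1%:M : 'M[C]_nS)) *t sigma) / 2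
      | sigma in [set sigma : 'M[C]_dE | is_state sigma]].

Definition cq_state nX dE (rhoE : 'I_nX -> 'M[C]_dE) : 'M[C]_(nX * dE) :=
  \sum_(x < nX) delta_mx x x *t rhoE x.

Definition hashed_state nX nS dE (f : {ffun 'I_nX -> 'I_nS})
  (rhoE : 'I_nX -> 'M[C]_dE) : 'M[C]_(nS * dE) :=
  \sum_(s < nS) delta_mx s s *t (\sum_(x < nX | f x == s) rhoE x).

Definition two_universal nX nS (F : {set {ffun 'I_nX -> 'I_nS}}) : Prop :=
  forall x x' : 'I_nX, x != x' ->
    (#|[set f in F | f x == f x']|%:R / #|F|%:R : R) <= (nS%:R)^-1.

Definition pow2e (x : \bar R) : \bar R :=
  match x with
  | EFin r => (2 `^ r)%:E
  | +oo%E => +oo%E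
  | -oo%E => 0%E
  end.

End QuantumInfo.

(* Main.v *)
(** Let tau be a subnormalised state with tau <= 2^-lam (1 (x) sigma) and
    purified distance at most eps from rho, and let t = tr tau. Compare the
    hashed rho with the maximally mixed state tensored with
    sigma' = tau_E + (1 - t) sigma, and write the trace norm of the difference
    as Re tr (V D) for a contraction V (polar decomposition). Replacing rho by
    tau costs Re tr (W (rho - tau)) for a contraction W pulled back along the
    hash function; together with the term (1 - t) coming from sigma' this is
    at most 2 eps by a Fuchs-van de Graaf inequality. The remaining term is
    the leftover hash lemma for the diagonal blocks of tau: a Cauchy-Schwarz
    inequality weighted by sigma^(1/4) reduces it to a variance over the
    two-universal family, and a non-uniform P is absorbed by
    P f <= 2^-beta = 2^(alpha - beta) / |F|. *)

Require Import Defs.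
From HB Require Import structures.
From mathcomp Require Import all_boot all_order all_algebra.
From mathcomp Require Import sesquilinear spectral.
From mathcomp Require Import complex mxtens.
From mathcomp Require Import all_classical all_reals.
From mathcomp Require Import ereal exp.
From mathcomp Require Import ring lra.

Import Order.TTheory GRing.Theory Num.Theory.
Local Open Scope ring_scope.

Section Hashing.
Set Implicit Arguments.
Unset Strict Implicit.
Unset Printing Implicit Defensive.

Variable R : realType.
Local Notation C := (R[i]).

(** * Real parts, adjoints and the real trace *)

Lemma ReD (x y : C) : complex.Re (x + y) = complex.Re x + complex.Re y.
Proof. by case: x; case: y. Qed.

Lemma ReN (x : C) : complex.Re (- x) = - complex.Re x.
Proof. by case: x. Qed.

Lemma Re_toCM (c : R) (x : C) : complex.Re (toC c * x) = c * complex.Re x.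
Proof. by case: x => a b /=; rewrite mul0r subr0. Qed.

Lemma toCM (a b : R) : toC (a * b) = toC a * toC b.
Proof. exact: (rmorphM (real_complex R)). Qed.

Lemma toC_conj (a : R) : (toC a)^* = toC a.
Proof. exact: conjc_real. Qed.

Lemma toC_ge0 (a : R) : 0 <= a -> 0 <= toC a.
Proof. by rewrite -(ler0c a). Qed.

Lemma toC_sqrt (a : R) : 0 <= a -> sqrtC (toC a) = toC (Num.sqrt a).
Proof.
move=> a0; apply/eqP; rewrite -(eqrXn2 (n := 2)) ?sqrtC_ge0 ?toC_ge0 ?sqrtr_ge0//.
by rewrite sqrtCK expr2 -toCM -expr2 sqr_sqrtr.
Qed.

Lemma adjmxK m n (A : 'M[C]_(m, n)) : adjmx (adjmx A) = A.
Proof. by apply/matrixP => i j; rewrite !mxE conjCK. Qed.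

Lemma adjmxM m n p (A : 'M[C]_(m, n)) (B : 'M[C]_(n, p)) :
  adjmx (A *m B) = adjmx B *m adjmx A.
Proof. by rewrite /adjmx map_mxM trmx_mul. Qed.

Lemma adjmxD m n (A B : 'M[C]_(m, n)) : adjmx (A + B) = adjmx A + adjmx B.
Proof. by rewrite /adjmx map_mxD linearD. Qed.

Lemma adjmx0 m n : adjmx (0 : 'M[C]_(m, n)) = 0.
Proof. by apply/matrixP => i j; rewrite !mxE conjC0. Qed.

Lemma trRD n (A B : 'M[C]_n) : trR (A + B) = trR A + trR B.
Proof. by rewrite /trR mxtraceD ReD. Qed.

Lemma trRN n (A : 'M[C]_n) : trR (- A) = - trR A.
Proof. by rewrite /trR raddfN ReN. Qed.

Lemma trRZ n (c : R) (A : 'M[C]_n) : trR (toC c *: A) = c * trR A.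
Proof. by rewrite /trR mxtraceZ Re_toCM. Qed.

Lemma trR0 n : trR (0 : 'M[C]_n) = 0.
Proof. by rewrite /trR mxtrace0. Qed.

Lemma trR_sum n (I : finType) (Q : pred I) (F : I -> 'M[C]_n) :
  trR (\sum_(i | Q i) F i) = \sum_(i | Q i) trR (F i).
Proof.
apply: (big_ind2 (fun (A : 'M[C]_n) b => trR A = b)) => //; first exact: trR0.
by move=> A a B b <- <-; rewrite trRD.
Qed.

Lemma trR_mulC m n (A : 'M[C]_(m, n)) (B : 'M[C]_(n, m)) :
  trR (A *m B) = trR (B *m A).
Proof. by rewrite /trR mxtrace_mulC. Qed.

Lemma trR_adj n (A : 'M[C]_n) : trR (adjmx A) = trR A.
Proof.
rewrite /trR /adjmx mxtrace_tr /mxtrace.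
have -> : \sum_i (map_mx Num.conj A) i i = (\sum_i A i i)^*.
  by rewrite rmorph_sum; apply: eq_bigr => i _; rewrite mxE.
by case: (\sum_i _).
Qed.

(** * The real Hilbert-Schmidt inner product *)

(** Taking the real part makes the Hilbert-Schmidt product symmetric and bilinear over the reals, so
    Cauchy-Schwarz involves no phases. *)
Definition rip m n (A B : 'M[C]_(m, n)) : R := trR (A *m adjmx B).

Lemma ripC m n (A B : 'M[C]_(m, n)) : rip A B = rip B A.
Proof. by rewrite /rip -trR_adj adjmxM adjmxK. Qed.

Lemma ripDl m n (A B D : 'M[C]_(m, n)) : rip (A + B) D = rip A D + rip B D.
Proof. by rewrite /rip mulmxDl trRD. Qed.

Lemma ripNl m n (A B : 'M[C]_(m, n)) : rip (- A) B = - rip A B.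
Proof. by rewrite /rip mulNmx trRN. Qed.

Lemma ripZl m n c (A B : 'M[C]_(m, n)) : rip (toC c *: A) B = c * rip A B.
Proof. by rewrite /rip -scalemxAl trRZ. Qed.

Lemma rip_suml m n (I : finType) (Q : pred I) (F : I -> 'M[C]_(m, n)) B :
  rip (\sum_(i | Q i) F i) B = \sum_(i | Q i) rip (F i) B.
Proof. by rewrite /rip mulmx_suml trR_sum. Qed.

Lemma ripDr m n (A B D : 'M[C]_(m, n)) : rip D (A + B) = rip D A + rip D B.
Proof. by rewrite ripC ripDl !(ripC D). Qed.

Lemma ripNr m n (A B : 'M[C]_(m, n)) : rip A (- B) = - rip A B.
Proof. by rewrite ripC ripNl ripC. Qed.

Lemma ripZr m n c (A B : 'M[C]_(m, n)) : rip A (toC c *: B) = c * rip A B.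
Proof. by rewrite ripC ripZl ripC. Qed.

Lemma rip_sumr m n (I : finType) (Q : pred I) (F : I -> 'M[C]_(m, n)) B :
  rip B (\sum_(i | Q i) F i) = \sum_(i | Q i) rip B (F i).
Proof. by rewrite ripC rip_suml; apply: eq_bigr => i _; rewrite ripC. Qed.

Lemma rip_mulr m n p (A : 'M[C]_(m, n)) (X : 'M[C]_(n, p)) (B : 'M[C]_(m, p)) :
  rip (A *m X) B = rip A (B *m adjmx X).
Proof. by rewrite /rip adjmxM adjmxK mulmxA. Qed.

Lemma rip_mull m n p (A : 'M[C]_(n, p)) (X : 'M[C]_(m, n)) (B : 'M[C]_(m, p)) :
  rip (X *m A) B = rip A (adjmx X *m B).
Proof. by rewrite /rip adjmxM adjmxK -mulmxA trR_mulC mulmxA. Qed.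

Lemma rip_adj m n (A B : 'M[C]_(m, n)) : rip (adjmx A) (adjmx B) = rip A B.
Proof. by rewrite /rip adjmxK trR_mulC -/(rip B A) ripC. Qed.

Lemma rip_entries m n (A : 'M[C]_(m, n)) :
  \tr (A *m adjmx A) = \sum_i \sum_j `|A i j| ^+ 2.
Proof.
by apply: eq_bigr => i _; rewrite mxE; apply: eq_bigr => j _; rewrite !mxE normCK.
Qed.

Lemma tr_rip m n (A : 'M[C]_(m, n)) : \tr (A *m adjmx A) = toC (rip A A).
Proof.
apply/esym/RRe_real/ger0_real; rewrite rip_entries.
by do 2!(apply: sumr_ge0 => ? _); rewrite exprn_ge0.
Qed.

Lemma rip_ge0 m n (A : 'M[C]_(m, n)) : 0 <= rip A A.
Proof.
rewrite -ler0c -[_%:C%C]/(toC _) -tr_rip rip_entries.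
by do 2!(apply: sumr_ge0 => ? _); rewrite exprn_ge0.
Qed.

Lemma rip_eq0 m n (A : 'M[C]_(m, n)) : rip A A = 0 -> A = 0.
Proof.
move=> A0; apply/matrixP => i j; rewrite mxE; apply/eqP.
have /eqP : \sum_i \sum_j `|A i j| ^+ 2 = 0 by rewrite -rip_entries tr_rip A0.
rewrite psumr_eq0 => [/allP/(_ i)|k _]; last first.
  by apply: sumr_ge0 => ? _; rewrite exprn_ge0.
rewrite mem_index_enum => /(_ isT); rewrite implyTb.
rewrite psumr_eq0 => [/allP/(_ j)|k _]; last by rewrite exprn_ge0.
by rewrite mem_index_enum => /(_ isT); rewrite implyTb expf_eq0 normr_eq0.
Qed.

Lemma rip_CS m n (A B : 'M[C]_(m, n)) : rip A B ^+ 2 <= rip A A * rip B B.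
Proof.
have [/eqP/rip_eq0 ->|b0] := boolP (rip B B == 0).
  by rewrite /rip adjmx0 !mulmx0 trR0 expr0n /= mulr0.
have Bgt0 : 0 < rip B B by rewrite lt_def b0 rip_ge0.
have := rip_ge0 (toC (rip B B) *: A - toC (rip A B) *: B).
rewrite !(ripDl, ripDr, ripNl, ripNr, ripZl, ripZr) (ripC B A).
set a := rip A A; set b := rip B B; set c := rip A B => h.
have : 0 <= b * (a * b - c ^+ 2) by lra.
by rewrite pmulr_rge0// subr_ge0.
Qed.

(** * Positive semidefinite matrices *)

Lemma mul_adjmx_psd m n (S : 'M[C]_(m, n)) : psdmx (S *m adjmx S).
Proof.
move=> v; rewrite mulmxA -mulmxA -adjmxM -trace_mx11 tr_rip.
exact/toC_ge0/rip_ge0.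
Qed.

Lemma psdmx_conj m n (A : 'M[C]_n) (X : 'M[C]_(m, n)) :
  psdmx A -> psdmx (X *m A *m adjmx X).
Proof. by move=> pA v; rewrite !mulmxA -mulmxA -adjmxM; exact: pA. Qed.

Lemma psdmxD n (A B : 'M[C]_n) : psdmx A -> psdmx B -> psdmx (A + B).
Proof. by move=> pA pB v; rewrite mulmxDr mulmxDl mxE addr_ge0. Qed.

Lemma psdmx0 n : psdmx (0 : 'M[C]_n).
Proof. by move=> v; rewrite mulmx0 mul0mx mxE. Qed.

Lemma psdmx_sum n (I : finType) (Q : pred I) (F : I -> 'M[C]_n) :
  (forall i, psdmx (F i)) -> psdmx (\sum_(i | Q i) F i).
Proof.
by move=> pF; apply: (big_ind (@psdmx R n)); [exact: psdmx0|exact: psdmxD|].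
Qed.

Lemma psdmxZ n (c : R) (A : 'M[C]_n) : 0 <= c -> psdmx A -> psdmx (toC c *: A).
Proof.
move=> c0 pA v; rewrite -scalemxAr -scalemxAl mxE.
by apply: mulr_ge0; [exact: toC_ge0|exact: pA].
Qed.

(** Polarisation: the vectors [u + v] and [u + i v] give the sum and the difference of the two cross
    terms, so each of them vanishes. *)
Lemma form_eq0 n (B : 'M[C]_n) :
  (forall v : 'rV[C]_n, v *m B *m adjmx v = 0) -> B = 0.
Proof.
move=> B0; apply/matrixP => i j.
have polar (u v : 'rV[C]_n) : u *m B *m adjmx v + v *m B *m adjmx u = 0.
  have := B0 (u + v); rewrite adjmxD !(mulmxDl, mulmxDr) !B0 addr0 add0r.
  by rewrite addrC.
pose im : C := Complex 0 1.
have im0 : im != 0 by rewrite eq_complex /= oner_eq0 andbF.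
set u : 'rV[C]_n := delta_mx 0 i; set v : 'rV[C]_n := delta_mx 0 j.
have h1 := polar u v; have h2 := polar u (im *: v).
have adji : adjmx (im *: v) = - im *: adjmx v.
  apply/matrixP => a b; rewrite !mxE rmorphM; congr (_ * _).
  by rewrite /im; apply/eqP; rewrite eq_complex /= oppr0 !eqxx.
rewrite adji -!scalemxAl -scalemxAr scaleNr addrC -scalerBr in h2.
move: h2 => /eqP; rewrite scaler_eq0 (negPf im0) orFb subr_eq0 => /eqP h2.
move: h1; rewrite h2 -mulr2n -scaler_nat => /eqP.
rewrite scaler_eq0 pnatr_eq0 orFb => /eqP /matrixP /(_ 0 0).
rewrite -rowE /v mxE (bigD1 j)//= big1 => [|k kj]; last first.
  by rewrite !mxE eqxx (negPf kj) conjC0 mulr0.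
by rewrite !mxE !eqxx conjC1 mulr1 addr0.
Qed.

(** [0 <= z] in the complex numbers entails that [z] is real, so the quadratic form of [adjmx A - A]
    vanishes. *)
Lemma psdmx_herm n (A : 'M[C]_n) : psdmx A -> adjmx A = A.
Proof.
move=> pA; apply/eqP; rewrite -subr_eq0; apply/eqP/form_eq0 => v.
rewrite mulmxBr mulmxBl; apply/eqP; rewrite subr_eq0; apply/eqP.
rewrite -{1}(adjmxK v) -adjmxM -adjmxM mulmxA.
apply/matrixP => i j; rewrite !ord1 !mxE; apply/CrealP/ger0_real.
by have := pA v; rewrite mxE.
Qed.

(** * Functional calculus in a unitary basis *)

(** For unitary [P], the rows of [P] are eigenvectors with eigenvalues [g i]. Since [g] acts on
    indices, all functions of one matrix share the same [P]. *)
Definition fcalc n (P : 'M[C]_n) (g : 'I_n -> R) : 'M[C]_n :=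
  adjmx P *m diag_mx (\row_i toC (g i)) *m P.

Lemma fcalc_adj n (P : 'M[C]_n) g : adjmx (fcalc P g) = fcalc P g.
Proof.
rewrite /fcalc !adjmxM adjmxK mulmxA; congr (_ *m _ *m _).
apply/matrixP => i j; rewrite !mxE eq_sym.
by case: eqVneq => [->|_]; rewrite ?mulr1n ?mulr0n ?conjC0//; exact: toC_conj.
Qed.

Lemma fcalcD n (P : 'M[C]_n) g h :
  fcalc P g + fcalc P h = fcalc P (fun i => g i + h i).
Proof.
rewrite /fcalc -mulmxDl -mulmxDr -raddfD /=; congr (_ *m diag_mx _ *m _).
by apply/rowP => i; rewrite !mxE -(rmorphD (real_complex R)).
Qed.

Lemma eq_fcalc n (P : 'M[C]_n) g h : g =1 h -> fcalc P g = fcalc P h.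
Proof.
by move=> gh; congr (_ *m diag_mx _ *m _); apply/rowP => i; rewrite !mxE gh.
Qed.

Section Unitary.
Variables (n : nat) (P : 'M[C]_n).
Hypothesis PU : P *m adjmx P = 1%:M.

Lemma fcalcM g h : fcalc P g *m fcalc P h = fcalc P (fun i => g i * h i).
Proof.
rewrite /fcalc !mulmxA -(mulmxA _ P) PU mulmx1 -(mulmxA (adjmx P)) mulmx_diag.
congr (_ *m diag_mx _ *m _).
by apply/rowP => i; rewrite !mxE toCM.
Qed.

Lemma fcalc1 : fcalc P (fun=> 1) = 1%:M.
Proof.
rewrite /fcalc; have -> : \row__ toC 1 = const_mx 1 :> 'rV[C]_n.
  by apply/rowP => i; rewrite !mxE.
by rewrite diag_const_mx mulmx1 (mulmx1C PU).
Qed.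

Lemma trR_fcalc g : trR (fcalc P g) = \sum_i g i.
Proof.
rewrite /fcalc trR_mulC mulmxA PU mul1mx /trR mxtrace_diag.
apply: (big_ind2 (fun (a : C) b => complex.Re a = b)) => //.
  by move=> a b c d <- <-; rewrite ReD.
by move=> i _; rewrite mxE.
Qed.
End Unitary.

Lemma spectralmxU n (A : 'M[C]_n) :
  spectralmx A *m adjmx (spectralmx A) = 1%:M.
Proof.
have /unitarymxP := spectral_unitarymx A.
by rewrite /adjmx map_trmx.
Qed.

Lemma invmx_spectral n (A : 'M[C]_n) :
  invmx (spectralmx A) = adjmx (spectralmx A).
Proof. by rewrite invmx_unitary ?spectral_unitarymx// /adjmx map_trmx. Qed.

Lemma psdmx_spectral n (A : 'M[C]_n) : psdmx A -> exists d : 'I_n -> R,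
  [/\ forall i, 0 <= d i, spectral_diag A = \row_i toC (d i) &
      A = fcalc (spectralmx A) d].
Proof.
move=> pA; set P := spectralmx A.
have tE m p (M : 'M[C]_(m, p)) : (map_mx Num.conj M^T) = adjmx M.
  by rewrite /adjmx map_trmx.
have PU : P *m adjmx P = 1%:M := spectralmxU A.
have nA : A \is normalmx by apply/normalmxP; rewrite tE psdmx_herm.
have := orthomx_spectralP nA; rewrite -/P invmx_spectral.
set s := spectral_diag A => AE.
(* An eigenvalue is the value of the quadratic form at a row of [P], hence a nonnegative real. *)
have sE i : s 0 i = (row i P *m A *m adjmx (row i P)) 0 0.
  have -> : row i P *m A *m adjmx (row i P) =
      row i (P *m A *m adjmx P) *m adjmx (row i 1%:M).
    by rewrite !rowE mulmx1 !mulmxA adjmxM !mulmxA.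
  rewrite AE !mulmxA PU mul1mx -mulmxA PU mulmx1.
  rewrite mxE (bigD1 i)//= big1 => [|k ki]; last first.
    by rewrite !mxE eq_sym (negPf ki) conjC0 mulr0.
  by rewrite !mxE !eqxx conjC1 mulr1 addr0.
have s0 i : 0 <= s 0 i by rewrite sE; exact: pA.
have sR i : toC (complex.Re (s 0 i)) = s 0 i by apply/RRe_real/ger0_real.
exists (fun i => complex.Re (s 0 i)); split.
- by move=> i; rewrite -ler0c -[_%:C%C]/(toC _) sR.
- by apply/rowP => i; rewrite mxE sR.
- rewrite {1}AE /fcalc; congr (_ *m diag_mx _ *m _).
  by apply/rowP => i; rewrite mxE sR.
Qed.

(** * Square roots and polar decomposition *)

Lemma sqrtmP n (A : 'M[C]_n) : psdmx A ->
  adjmx (sqrtm A) = sqrtm A /\ sqrtm A *m sqrtm A = A.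
Proof.
move=> /psdmx_spectral [d [d0 sE AE]].
have sA : sqrtm A = fcalc (spectralmx A) (fun i => Num.sqrt (d i)).
  have E : map_mx sqrtC (spectral_diag A) = \row_i toC (Num.sqrt (d i)).
    by apply/rowP => i; rewrite sE !mxE toC_sqrt.
  by rewrite /sqrtm E invmx_spectral.
rewrite sA; split; first exact: fcalc_adj.
rewrite (fcalcM (spectralmxU A)) [RHS]AE.
by apply: eq_fcalc => i; rewrite -expr2 sqr_sqrtr.
Qed.

(** For square roots [S] and [T] of the two matrices, the product equals the squared norm of
    [S *m T]. *)
Lemma rip_psd_ge0 n (A B : 'M[C]_n) : psdmx A -> psdmx B -> 0 <= rip A B.
Proof.
move=> /sqrtmP []; move: (sqrtm A) => S aS <-.
move=> /sqrtmP []; move: (sqrtm B) => T aT <-.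
suff -> : rip (S *m S) (T *m T) = rip (S *m T) (S *m T) by exact: rip_ge0.
by rewrite /rip !adjmxM aS aT -mulmxA trR_mulC !mulmxA.
Qed.

Lemma psdmx_rip n (A : 'M[C]_n) : psdmx A -> trR A = rip (sqrtm A) (sqrtm A).
Proof. by move=> /sqrtmP [aA AA]; rewrite /rip aA AA. Qed.

Lemma psdmx_tr n (A : 'M[C]_n) : psdmx A -> \tr A = toC (trR A).
Proof.
move=> pA; have [aA AA] := sqrtmP pA.
by rewrite psdmx_rip// -tr_rip aA AA.
Qed.

(* Polar decomposition: [V] is a partial isometry and [N] the projector
   completing it, so no unitary extension is needed. *)
Lemma trnorm_polar n (M : 'M[C]_n) : exists V N : 'M[C]_n,
  trR (V *m M) = trnorm M /\ V *m adjmx V + N *m adjmx N = 1%:M.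
Proof.
have pM : psdmx (adjmx M *m M) by have := mul_adjmx_psd (adjmx M); rewrite adjmxK.
have [d [d0 sE ME]] := psdmx_spectral pM.
have PU := spectralmxU (adjmx M *m M).
set P := spectralmx _ in ME PU *.
(* Since [0^-1 = 0], [V] inverts the modulus of [M] on its support only; [N] projects onto the
   kernel of [M]. *)
exists (fcalc P (fun i => (Num.sqrt (d i))^-1) *m adjmx M).
exists (fcalc P (fun i => (d i == 0)%:R)); split.
  rewrite -mulmxA ME fcalcM// trR_fcalc// /trnorm sE.
  apply/esym; apply: (big_ind2 (fun (a : C) b => complex.Re a = b)) => //.
    by move=> a b c e <- <-; rewrite ReD.
  move=> i _; rewrite mxE toC_sqrt//=.
  have [->|di] := eqVneq (d i) 0; first by rewrite mulr0 sqrtr0.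
  rewrite -[X in _ * X](sqr_sqrtr (d0 i)) expr2 mulrA mulVf ?mul1r//.
  by rewrite sqrtr_eq0 -ltNge lt_def di d0.
rewrite adjmxM adjmxK !fcalc_adj mulmxA -(mulmxA _ (adjmx M)) ME !fcalcM// fcalcD.
rewrite -(fcalc1 PU); apply: eq_fcalc => i.
have [->|di] := eqVneq (d i) 0; first by rewrite mulr0 mul0r mulr1 add0r.
have sd : Num.sqrt (d i) != 0 by rewrite sqrtr_eq0 -ltNge lt_def di d0.
by rewrite mulr0 addr0 mulrAC -invfM -expr2 sqr_sqrtr// mulVf.
Qed.

Lemma trnorm_ge0 n (M : 'M[C]_n) : 0 <= trnorm M.
Proof.
have pM : psdmx (adjmx M *m M) by have := mul_adjmx_psd (adjmx M); rewrite adjmxK.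
have [d [d0 sE ME]] := psdmx_spectral pM.
rewrite /trnorm sE; apply: (big_ind (fun a : C => 0 <= complex.Re a)) => //.
  by move=> a b a0 b0; rewrite ReD addr_ge0.
by move=> i _; rewrite mxE toC_sqrt//= sqrtr_ge0.
Qed.

(** * Contractions *)

(** Operator norm at most 1, tested on any number of rows so that it applies to rectangular
    factors. *)
Definition contraction n (V : 'M[C]_n) : Prop :=
  forall m (X : 'M[C]_(m, n)), rip (X *m V) (X *m V) <= rip X X.

Lemma complemented_contraction n (V N : 'M[C]_n) :
  V *m adjmx V + N *m adjmx N = 1%:M -> contraction V.
Proof.
move=> VN m X; rewrite -subr_ge0 rip_mulr -mulmxA -ripNr -ripDr.
have -> : X - X *m (V *m adjmx V) = X *m N *m adjmx N.
  by rewrite -{1}(mulmx1 X) -VN mulmxDr addrC addKr mulmxA.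
by rewrite ripC rip_mulr adjmxK rip_ge0.
Qed.

(** By Cauchy-Schwarz, the squared norm [b] of [X V^*] is at most the norm of [X V^* V] times that
    of [X]; bounding the former by the norm of [X V^*] lets one factor [b] cancel. *)
Lemma contraction_adj n (V : 'M[C]_n) : contraction V -> contraction (adjmx V).
Proof.
move=> cV m X; set b := rip (X *m adjmx V) (X *m adjmx V).
have : b ^+ 2 <= b * rip X X.
  rewrite {1}/b rip_mulr adjmxK mulrC; apply: le_trans (rip_CS _ _) _.
  by rewrite ler_wpM2l ?rip_ge0// cV.
have [b0|b0 _] := ltP 0 b; last exact: le_trans b0 (rip_ge0 _).
by rewrite expr2 ler_pM2l.
Qed.

Lemma contraction_psd n (V A : 'M[C]_n) :
  contraction V -> psdmx A -> `|trR (V *m A)| <= trR A.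
Proof.
move=> cV pA; have [aA AA] := sqrtmP pA; set S := sqrtm A in aA AA.
have -> : trR (V *m A) = rip (S *m V) S by rewrite /rip aA -mulmxA [RHS]trR_mulC -mulmxA AA.
rewrite -(@ler_pXn2r _ 2)// ?nnegrE ?psdmx_rip ?rip_ge0// real_normK ?num_real//.
apply: le_trans (rip_CS _ _) _.
by rewrite expr2 ler_wpM2r ?rip_ge0// cV.
Qed.

(** * Block decomposition of a tensor product *)

(* The isometry v |-> |s> (x) v, in row-vector convention. *)
Definition emb k d (s : 'I_k) : 'M[C]_(d, k * d) :=
  \matrix_(i, j) (j == mxtens_index (s, i))%:R.

Lemma mul_embE k d m (s a : 'I_k) (B : 'M[C]_(m, d)) i j :
  (B *m emb d s) i (mxtens_index (a, j)) = (a == s)%:R * B i j.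
Proof.
rewrite mxE (bigD1 j)//= big1 => [|l lj].
  rewrite mxE addr0 mulrC (can_eq (@mxtens_indexK k d)).
  by rewrite xpair_eqE eqxx andbT.
by rewrite mxE (can_eq (@mxtens_indexK k d)) xpair_eqE (eq_sym j) (negPf lj) andbF mulr0.
Qed.

Lemma mul_adj_embE k d m (s a : 'I_k) (B : 'M[C]_(d, m)) i j :
  (adjmx (emb d s) *m B) (mxtens_index (a, i)) j = (a == s)%:R * B i j.
Proof.
rewrite mxE (bigD1 i)//= big1 => [|l li].
  rewrite !mxE conjC_nat addr0 (can_eq (@mxtens_indexK k d)).
  by rewrite xpair_eqE eqxx andbT.
rewrite !mxE conjC_nat (can_eq (@mxtens_indexK k d)) xpair_eqE.
by rewrite (eq_sym i) (negPf li) andbF mul0r.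
Qed.

Lemma delta_tensE k d (s : 'I_k) (A : 'M[C]_d) :
  delta_mx s s *t A = adjmx (emb d s) *m A *m emb d s.
Proof.
apply/matrixP => p q; case: (mxtens_indexP p) => a i.
case: (mxtens_indexP q) => b j.
rewrite tensmxE mul_embE mul_adj_embE mxE mulrA -natrM mulnb.
by rewrite andbC.
Qed.

Lemma scalar_tensE k d (c : C) (A : 'M[C]_d) :
  (c *: (1%:M : 'M[C]_k)) *t A = c *: \sum_s adjmx (emb d s) *m A *m emb d s.
Proof.
apply/matrixP => p q; case: (mxtens_indexP p) => a i.
case: (mxtens_indexP q) => b j.
rewrite tensmxE !mxE summxE -mulrA; congr (_ * _).
rewrite (bigD1 b)//= big1 => [|s sb]; last first.
  by rewrite mul_embE eq_sym (negPf sb) mul0r.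
by rewrite mul_embE mul_adj_embE eqxx mul1r addr0.
Qed.

Lemma emb_sum k d : \sum_(s < k) adjmx (emb d s) *m emb d s = 1%:M.
Proof.
apply/matrixP => p q; case: (mxtens_indexP p) => a i.
case: (mxtens_indexP q) => b j.
rewrite summxE (bigD1 b)//= big1 => [|s sb]; last first.
  by rewrite mul_embE eq_sym (negPf sb) mul0r.
rewrite mul_embE eqxx mul1r addr0 -[adjmx _]mulmx1 mul_adj_embE !mxE.
by rewrite -natrM mulnb (can_eq (@mxtens_indexK k d)) xpair_eqE.
Qed.

Lemma emb_orth k d (s t : 'I_k) : emb d s *m adjmx (emb d t) = (s == t)%:R%:M.
Proof.
apply/matrixP => i j; rewrite mxE (bigD1 (mxtens_index (s, i)))//= big1.
  by rewrite !mxE eqxx mul1r addr0 (can_eq (@mxtens_indexK k d)) xpair_eqE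
     -mulnb natrM; case: (s == t) (i == j) => -[]; rewrite ?mul0r ?mul1r ?conjC1 ?conjC0.
by move=> q qs; rewrite mxE (negPf qs) mul0r.
Qed.

Lemma emb_id k d (s : 'I_k) : emb d s *m adjmx (emb d s) = 1%:M.
Proof. by rewrite emb_orth eqxx. Qed.

Definition blk k d (V : 'M[C]_(k * d)) (s : 'I_k) : 'M[C]_d :=
  emb d s *m V *m adjmx (emb d s).

Lemma rip_emb_sum k d m (X : 'M[C]_(m, k * d)) :
  \sum_s rip (X *m adjmx (emb d s)) (X *m adjmx (emb d s)) = rip X X.
Proof.
have -> : rip X X = rip (X *m 1%:M) X by rewrite mulmx1.
rewrite -emb_sum mulmx_sumr rip_suml; apply: eq_bigr => s _.
by rewrite mulmxA (rip_mulr (X *m _) (emb d s)).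
Qed.

Lemma blk_contraction k d (V : 'M[C]_(k * d)) s :
  contraction V -> contraction (blk V s).
Proof.
move=> cV m X; rewrite /blk !mulmxA; set Y := X *m emb d s.
have -> : rip X X = rip Y Y by rewrite /Y rip_mulr -mulmxA emb_id mulmx1.
(* The squared norm of [Y *m V] splits over its column blocks, and only block [s] is kept. *)
apply: le_trans (cV _ Y); rewrite -(rip_emb_sum (Y *m V)) (bigD1 s)//= lerDl.
by apply: sumr_ge0 => t _; exact: rip_ge0.
Qed.

(** The same block may occur at several positions, which is what pulling back along a hash function
    produces. *)
Lemma diag_contraction k d (V : 'I_k -> 'M[C]_d) :
  (forall s, contraction (V s)) ->
  contraction (\sum_s adjmx (emb d s) *m V s *m emb d s).
Proof.
move=> cV m X; rewrite -(rip_emb_sum X) -(rip_emb_sum (_ *m _)).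
apply: ler_sum => s _; rewrite mulmx_sumr mulmx_suml (bigD1 s)//= big1 => [|t ts].
  by rewrite addr0 -!mulmxA emb_id mulmx1 mulmxA; exact: cV.
by rewrite -!mulmxA emb_orth (negPf ts) raddf0 !mulmx0.
Qed.

(** * A Fuchs-van de Graaf inequality *)

Lemma adjmx_row m n p (A : 'M[C]_(m, n)) (B : 'M[C]_(m, p)) :
  adjmx (row_mx A B) = col_mx (adjmx A) (adjmx B).
Proof. by rewrite /adjmx map_row_mx tr_row_mx. Qed.

Lemma sqr_mean_le (t a b M : R) :
  2 * t = a + b -> a ^+ 2 <= M -> b ^+ 2 <= M -> t ^+ 2 <= M.
Proof.
move=> tab aM bM; have := sqr_ge0 (a - b).
have -> : t = (a + b) / 2 by lra.
nra.
Qed.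

(* Factor rho = A A^* and tau = B B^* with Re tr (A^* B) = F; then
   2 (rho - tau) = (A + B) (A - B)^* + (A - B) (A + B)^* and Cauchy-Schwarz
   applies since |A +- B|^2 = tr rho + tr tau +- 2 F. *)
Lemma fuchs_van_de_graaf n (rho tau W : 'M[C]_n) :
  psdmx rho -> psdmx tau -> contraction W ->
  trR (W *m (rho - tau)) ^+ 2 <=
    (trR rho + trR tau) ^+ 2 - 4 * trnorm (sqrtm rho *m sqrtm tau) ^+ 2.
Proof.
move=> /sqrtmP [] + + /sqrtmP []; move: (sqrtm rho) (sqrtm tau) => S T.
move=> aS SS aT TT cW; have [V [N [<- VN]]] := trnorm_polar (S *m T).
(* Two purifications with optimal overlap. The column block [T *m N] restores [B B^* = tau], as [V]
   need not be unitary. *)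
pose A : 'M[C]_(n, n + n) := row_mx S 0.
pose B : 'M[C]_(n, n + n) := row_mx (T *m V) (T *m N).
have AA : A *m adjmx A = rho.
  by rewrite /A adjmx_row mul_row_col adjmx0 mulmx0 addr0 aS SS.
have BB : B *m adjmx B = tau.
  rewrite /B adjmx_row mul_row_col !adjmxM aT -!mulmxA -mulmxDr !mulmxA.
  by rewrite -mulmxDl VN mul1mx TT.
have BA : rip B A = trR (V *m (S *m T)).
  rewrite /rip /A /B adjmx_row mul_row_col adjmx0 mulmx0 addr0 aS.
  by rewrite -mulmxA trR_mulC mulmxA.
have cWl m (X : 'M[C]_(n, m)) : rip (W *m X) (W *m X) <= rip X X.
  rewrite -rip_adj adjmxM -(rip_adj X); exact: contraction_adj.
set X := A + B; set Y := A - B; set F := trR (V *m _) in BA *.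
have XX : rip X X = trR rho + trR tau + 2 * F.
  rewrite /X !(ripDl, ripDr) (ripC A B) BA {1 2}/rip AA BB; lra.
have YY : rip Y Y = trR rho + trR tau - 2 * F.
  rewrite /Y !(ripDl, ripDr, ripNl, ripNr) (ripC A B) BA {1 2}/rip AA BB; lra.
have wA : trR (W *m rho) = rip (W *m A) A by rewrite /rip -mulmxA AA.
have wB : trR (W *m tau) = rip (W *m B) B by rewrite /rip -mulmxA BB.
have two : 2 * trR (W *m (rho - tau)) = rip (W *m X) Y + rip (W *m Y) X.
  rewrite mulmxBr trRD trRN wA wB /X /Y !(mulmxDr, mulmxN).
  rewrite !(ripDl, ripDr, ripNl, ripNr).
  move: (rip (W *m A) A) (rip (W *m A) B) (rip (W *m B) A) (rip (W *m B) B).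
  by move=> w x y z; ring.
have -> : (trR rho + trR tau) ^+ 2 - 4 * F ^+ 2 = rip X X * rip Y Y.
  by rewrite XX YY; ring.
apply: sqr_mean_le two _ _; apply: le_trans (rip_CS _ _) _.
  by rewrite ler_wpM2r ?rip_ge0.
by rewrite [leRHS]mulrC ler_wpM2r ?rip_ge0.
Qed.

(** * Weighting by the fourth root of a state *)

Section Root4.
Variables (n : nat) (P : 'M[C]_n).
Hypothesis PU : P *m adjmx P = 1%:M.

Lemma fcalc_mulV (g : 'I_n -> R) :
  fcalc P g *m fcalc P (fun i => (g i)^-1) =
  1%:M - fcalc P (fun i => (g i == 0)%:R).
Proof.
rewrite (fcalcM PU); apply/esym/(canLR (addrK _)).
rewrite -(fcalc1 PU) fcalcD; apply: eq_fcalc => i.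
by case: eqVneq => [->|gi]; rewrite ?mul0r ?add0r// mulfV ?addr0.
Qed.

(** The witnesses are the fourth root [Z], its inverse [W] on the support, and the projector [N]
    onto the kernel, which handles singular matrices. *)
Lemma fcalc_root4 (d : 'I_n -> R) : (forall i, 0 <= d i) ->
  exists Z W N : 'M[C]_n,
  [/\ adjmx Z = Z, adjmx W = W, adjmx N = N,
      rip (Z *m Z) (Z *m Z) = trR (fcalc P d) &
  [/\ Z *m W = 1%:M - N, W *m Z = 1%:M - N,
      N *m fcalc P d *m N = 0 & W *m W *m fcalc P d *m W *m W = 1%:M - N]].
Proof.
move=> d0; pose q i := Num.sqrt (Num.sqrt (d i)).
have q4 i : q i * q i * (q i * q i) = d i.
  by rewrite -[q i * q i]expr2 sqr_sqrtr ?sqrtr_ge0// -expr2 sqr_sqrtr.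
exists (fcalc P q), (fcalc P (fun i => (q i)^-1)).
exists (fcalc P (fun i => (q i == 0)%:R)).
split; rewrite ?fcalc_adj//; last split.
- rewrite /rip (fcalcM PU) fcalc_adj (fcalcM PU); congr trR.
  exact: eq_fcalc.
- exact: fcalc_mulV.
- rewrite -fcalc_mulV 2!(fcalcM PU).
  by apply: eq_fcalc => i; rewrite mulrC.
- rewrite 2!(fcalcM PU); apply: rip_eq0.
  rewrite /rip fcalc_adj (fcalcM PU) (trR_fcalc PU) big1 // => i _.
  by rewrite -q4; case: eqVneq => [->|_] /=; rewrite !(mulr0, mul0r, mulr0n).
- rewrite -fcalc_mulV 5!(fcalcM PU); apply: eq_fcalc => i; rewrite -q4.
  have [->|qi] := eqVneq (q i) 0; first by rewrite invr0 !mul0r.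
  by field.
Qed.
End Root4.

(** Domination by [sigma] puts the support of [A] inside that of [sigma], so conjugation by [W] is
    undone by [Z]. The norm bound is positivity of the inner product of [W (c sigma - A) W] with
    [W A W]. *)
Lemma root4_exists n (sigma : 'M[C]_n) : psdmx sigma -> exists Z W : 'M[C]_n,
  [/\ adjmx Z = Z, adjmx W = W, rip (Z *m Z) (Z *m Z) = trR sigma &
   forall c A, psdmx A -> lemx A (toC c *: sigma) ->
     Z *m (W *m A *m W) *m Z = A /\ rip (W *m A *m W) (W *m A *m W) <= c * trR A].
Proof.
move=> ps; have [d [d0 _ sE]] := psdmx_spectral ps.
have := fcalc_root4 (spectralmxU sigma) d0; rewrite -sE.
move=> [Z [W [N [aZ aW aN ZZ [ZW WZ NsN WsW]]]]].
exists Z, W; split=> // c A pA lA; have [aS SS] := sqrtmP pA.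
(* The squared norm of [N *m sqrtm A] is the trace of [N A N], at most [c] times that of
   [N sigma N], which is 0. *)
have NA : N *m A = 0.
  rewrite -SS mulmxA; suff -> : N *m sqrtm A = 0 by rewrite mul0mx.
  apply: rip_eq0; apply/eqP; rewrite eq_le rip_ge0 andbT.
  have -> : rip (N *m sqrtm A) (N *m sqrtm A) = trR (N *m A *m adjmx N).
    by rewrite /rip adjmxM aS -[in RHS]SS !mulmxA.
  have := rip_ge0 (sqrtm (N *m (toC c *: sigma - A) *m adjmx N)).
  rewrite -psdmx_rip; last exact: psdmx_conj.
  rewrite mulmxBr mulmxBl trRD trRN subr_ge0 => /le_trans; apply.
  by rewrite -scalemxAr -scalemxAl aN NsN scaler0 trR0.
have AN : A *m N = 0.
  by rewrite -(psdmx_herm pA) -aN -adjmxM NA adjmx0.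
split.
  rewrite !mulmxA ZW -mulmxA WZ mulmxBl mul1mx NA subr0 mulmxBr mulmx1 AN.
  by rewrite subr0.
have pW B : psdmx B -> psdmx (W *m B *m W) by rewrite -{2}aW; exact: psdmx_conj.
have := rip_psd_ge0 (pW _ lA) (pW _ pA).
rewrite mulmxBr mulmxBl ripDl ripNl subr_ge0 => /le_trans; apply.
rewrite -scalemxAr -scalemxAl ripZl.
suff -> : rip (W *m sigma *m W) (W *m A *m W) = trR A by [].
rewrite /rip !adjmxM aW (psdmx_herm pA) !mulmxA trR_mulC !mulmxA WsW.
by rewrite mulmxBl mul1mx NA subr0.
Qed.

(** Moving one [Z] across pairs [Z V Z] with [M^*]. The squared norm of [Z V Z] is the inner product
    of [Z^2 V] with [V Z^2], both of norm at most that of [Z^2]. *)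
Lemma weighted_CS n (Z V M : 'M[C]_n) : adjmx Z = Z -> contraction V ->
  trR (V *m (Z *m M *m Z)) ^+ 2 <= rip (Z *m Z) (Z *m Z) * rip M M.
Proof.
move=> aZ cV; set t := rip (Z *m Z) _.
have -> : trR (V *m (Z *m M *m Z)) = rip (Z *m V *m Z) (adjmx M).
  by rewrite /rip adjmxK !mulmxA [LHS]trR_mulC !mulmxA.
apply: le_trans (rip_CS _ _) _; rewrite rip_adj ler_wpM2r ?rip_ge0//.
have h : rip (Z *m V *m Z) (Z *m V *m Z) ^+ 2 <= t ^+ 2.
  have -> : rip (Z *m V *m Z) (Z *m V *m Z) = rip (Z *m Z *m V) (V *m (Z *m Z)).
    by rewrite -[in LHS]mulmxA rip_mull aZ ripC !mulmxA rip_mulr aZ.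
  apply: le_trans (rip_CS _ _) _; rewrite [leRHS]expr2.
  apply: ler_pM (rip_ge0 _) (rip_ge0 _) (cV _ (Z *m Z)) _.
  rewrite -rip_adj !adjmxM aZ; exact: (contraction_adj cV).
by rewrite -(@ler_pXn2r _ 2)// nnegrE rip_ge0.
Qed.

(** * The leftover hash lemma *)

Lemma sqr_sum_le (I : finType) (A : {pred I}) (a : I -> R) :
  (\sum_(i in A) a i) ^+ 2 <= #|A|%:R * \sum_(i in A) a i ^+ 2.
Proof.
have [A0|A0] := eqVneq #|A| 0%N.
  by rewrite A0 mul0r big_pred0 ?expr0n// => i; exact: (card0_eq A0).
set S := \sum_(i in A) a i; set n : R := #|A|%:R.
have n0 : 0 < n by rewrite ltr0n lt0n.
have : 0 <= \sum_(i in A) (n ^+ 2 * a i ^+ 2 - 2 * n * S * a i + S ^+ 2).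
  apply: sumr_ge0 => i _; rewrite (_ : _ + _ = (n * a i - S) ^+ 2) ?sqr_ge0//.
  by ring.
rewrite big_split sumrB -!mulr_sumr sumr_const -mulr_natl -/n -/S /=.
set Q := \sum_(i in A) _ => h.
have : 0 <= n * (n * Q - S ^+ 2) by nra.
by rewrite pmulr_rge0// subr_ge0.
Qed.

Lemma variance_le k n (A : 'I_k -> 'M[C]_n) (S := \sum_s A s) : (0 < k)%N ->
  \sum_s rip (A s - toC k%:R^-1 *: S) (A s - toC k%:R^-1 *: S) =
  \sum_s rip (A s) (A s) - k%:R^-1 * rip S S.
Proof.
move=> k0; have kn0 : (k%:R : R) != 0 by rewrite pnatr_eq0 -lt0n.
transitivity (\sum_s (rip (A s) (A s) - 2 * k%:R^-1 * rip (A s) S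
    + k%:R^-1 ^+ 2 * rip S S)).
  apply: eq_bigr => s _.
  rewrite !(ripDl, ripDr, ripNl, ripNr, ripZl, ripZr) (ripC S).
  by move: (rip (A s) (A s)) (rip (A s) S) (rip S S) => a b c; ring.
rewrite big_split sumrB -!mulr_sumr -rip_suml -/S sumr_const card_ord /=.
by rewrite -mulr_natl; field.
Qed.

Lemma collision_sum nX nS n (f : {ffun 'I_nX -> 'I_nS}) (M : 'I_nX -> 'M[C]_n) :
  \sum_s rip (\sum_(x | f x == s) M x) (\sum_(x | f x == s) M x) =
  \sum_x \sum_x' (f x == f x')%:R * rip (M x) (M x').
Proof.
rewrite [RHS](partition_big f xpredT)//=; apply: eq_bigr => s _.
rewrite rip_suml; apply: eq_bigr => x /eqP ->.
rewrite rip_sumr big_mkcond; apply: eq_bigr => x' _.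
by rewrite eq_sym; case: ifP => _; rewrite ?mul1r ?mul0r.
Qed.

(** Expanded over pairs, the product of [M x] and [M x'] has weight [(f x == f x') - 1/nS]. Summed
    over [F], this weight is at most 0 off the diagonal by two-universality, and at most [#|F|] on
    it; nonnegative inner products let the off-diagonal terms be dropped. *)
Lemma two_universal_variance nX nS n (F : {set {ffun 'I_nX -> 'I_nS}})
    (M : 'I_nX -> 'M[C]_n) : (0 < nS)%N -> (0 < #|F|)%N -> two_universal R F ->
  (forall x x', 0 <= rip (M x) (M x')) ->
  \sum_(f in F) \sum_s
    rip (\sum_(x | f x == s) M x - toC nS%:R^-1 *: \sum_x M x)
        (\sum_(x | f x == s) M x - toC nS%:R^-1 *: \sum_x M x)
  <= #|F|%:R * \sum_x rip (M x) (M x).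
Proof.
move=> k0 F0 uF M0; set g := fun x x' => rip (M x) (M x').
have cF : 0 < #|F|%:R :> R by rewrite ltr0n.
rewrite (eq_bigr (fun f : {ffun 'I_nX -> 'I_nS} => \sum_x \sum_x'
    ((f x == f x')%:R - nS%:R^-1) * g x x')); last first.
  move=> f _; have Mf : \sum_x M x = \sum_s \sum_(x | f x == s) M x.
    by rewrite (partition_big f xpredT).
  rewrite Mf variance_le// collision_sum -Mf rip_suml mulr_sumr -sumrB.
  apply: eq_bigr => x _; rewrite rip_sumr mulr_sumr -sumrB.
  by apply: eq_bigr => x' _; rewrite mulrBl.
rewrite exchange_big mulr_sumr; apply: ler_sum => x _.
rewrite exchange_big (bigD1 x)//= -[leRHS]addr0 lerD//.
  rewrite -mulr_suml ler_wpM2r ?M0// -sum1_card natr_sum; apply: ler_sum => f _.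
  by rewrite eqxx lerBlDr lerDl invr_ge0.
apply: sumr_le0 => x' xx'; rewrite -mulr_suml mulr_le0_ge0 ?M0// sumrB sumr_const.
have := uF x x'; rewrite eq_sym => /(_ xx'); rewrite ler_pdivrMr//.
rewrite subr_le0 mulr_natr; apply: le_trans.
rewrite -sum1dep_card natr_sum big_mkcondr /= le_eqVlt; apply/orP; left; apply/eqP.
by apply: eq_bigr => f _; case: eqP.
Qed.

(** Arbitrary contractions [V f s] stand in for those attaining the trace norm, so the distances
    enter as linear functionals. *)
Lemma leftover_hash nX nS n (F : {set {ffun 'I_nX -> 'I_nS}}) (c : R)
    (sigma : 'M[C]_n) (tau : 'I_nX -> 'M[C]_n)
    (V : {ffun 'I_nX -> 'I_nS} -> 'I_nS -> 'M[C]_n) :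
  (0 < nS)%N -> (0 < #|F|)%N -> two_universal R F ->
  psdmx sigma -> trR sigma = 1 -> (forall x, psdmx (tau x)) ->
  (forall x, lemx (tau x) (toC c *: sigma)) ->
  (forall f s, contraction (V f s)) ->
  \sum_(f in F) `|\sum_s trR (V f s *m
      (\sum_(x | f x == s) tau x - toC nS%:R^-1 *: \sum_x tau x))|
  <= #|F|%:R * Num.sqrt (nS%:R * (c * \sum_x trR (tau x))).
Proof.
move=> k0 F0 uF ps ts pt lt cV.
have [Z [W [aZ aW ZZ ZW]]] := root4_exists ps.
pose M x := W *m tau x *m W.
have tauM x : Z *m M x *m Z = tau x by have [] := ZW _ _ (pt x) (lt x).
have pM x : psdmx (M x).
  by have := psdmx_conj W (pt x); rewrite aW.
pose D (f : {ffun 'I_nX -> 'I_nS}) s :=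
  \sum_(x | f x == s) tau x - toC nS%:R^-1 *: \sum_x tau x.
pose E (f : {ffun 'I_nX -> 'I_nS}) s := \sum_(x | f x == s) M x - toC nS%:R^-1 *: \sum_x M x.
have DE f s : D f s = Z *m E f s *m Z.
  rewrite /D /E mulmxBr mulmxBl -scalemxAr -scalemxAl !mulmx_sumr !mulmx_suml.
  by congr (_ - _ *: _); apply: eq_bigr => x _; rewrite tauM.
have EV : \sum_(f in F) \sum_s rip (E f s) (E f s)
    <= #|F|%:R * (c * \sum_x trR (tau x)).
  apply: le_trans (two_universal_variance k0 F0 uF _) _.
    by move=> x x'; exact: rip_psd_ge0.
  rewrite ler_wpM2l// mulr_sumr; apply: ler_sum => x _.
  by have [] := ZW _ _ (pt x) (lt x).
set L := \sum_(f in F) _.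
have L0 : 0 <= L by apply: sumr_ge0 => f _.
(* Cauchy-Schwarz over [F] and then over [s] gives factors [#|F|] and [nS]; [EV] supplies the second
   [#|F|]. *)
have L2 : L ^+ 2 <= #|F|%:R ^+ 2 * (nS%:R * (c * \sum_x trR (tau x))).
  apply: le_trans (sqr_sum_le _ _) _.
  rewrite expr2 -mulrA ler_wpM2l// mulrCA.
  apply: le_trans (ler_wpM2l (ler0n _ _) EV).
  rewrite mulr_sumr; apply: ler_sum => f _; rewrite real_normK ?num_real//.
  have := sqr_sum_le predT (fun s : 'I_nS => trR (V f s *m D f s)).
  rewrite card_ord => /le_trans; apply; rewrite ler_wpM2l//.
  apply: ler_sum => s _; rewrite DE.
  by apply: le_trans (weighted_CS _ aZ (cV f s)) _; rewrite ZZ ts mul1r.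
(* The radicand is nonnegative because [L2] bounds a square by a positive multiple of it. *)
have B0 : 0 <= nS%:R * (c * \sum_x trR (tau x)).
  by have := le_trans (sqr_ge0 _) L2; rewrite pmulr_rge0// exprn_gt0// ltr0n.
rewrite -(@ler_pXn2r _ 2)// ?nnegrE ?mulr_ge0 ?sqrtr_ge0//.
by rewrite exprMn sqr_sqrtr.
Qed.

(** * Blocks of cq and hashed states; the smoothing estimate *)

Lemma trR_blk k d (V : 'M[C]_(k * d)) (A : 'M[C]_d) s :
  trR (V *m (adjmx (emb d s) *m A *m emb d s)) = trR (blk V s *m A).
Proof. by rewrite /blk !mulmxA trR_mulC !mulmxA. Qed.

Lemma blk_diag k d (A : 'I_k -> 'M[C]_d) s :
  blk (\sum_t adjmx (emb d t) *m A t *m emb d t) s = A s.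
Proof.
rewrite /blk mulmx_sumr mulmx_suml (bigD1 s)//= big1 => [|t ts].
  by rewrite addr0 !mulmxA emb_id mul1mx -mulmxA emb_id mulmx1.
by rewrite !mulmxA emb_orth eq_sym (negPf ts) raddf0 !mul0mx.
Qed.

Lemma blkB k d (A B : 'M[C]_(k * d)) s : blk (A - B) s = blk A s - blk B s.
Proof. by rewrite /blk mulmxBr mulmxBl. Qed.

Lemma sum_trR_blk k d (A : 'M[C]_(k * d)) : \sum_s trR (blk A s) = trR A.
Proof.
rewrite -[in RHS](mulmx1 A) -emb_sum mulmx_sumr trR_sum; apply: eq_bigr => s _.
by rewrite /blk -mulmxA trR_mulC mulmxA.
Qed.

Lemma cq_stateE nX d (rhoE : 'I_nX -> 'M[C]_d) :
  cq_state rhoE = \sum_x adjmx (emb d x) *m rhoE x *m emb d x.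
Proof. by apply: eq_bigr => x _; rewrite delta_tensE. Qed.

Lemma psdmx_blk k d (A : 'M[C]_(k * d)) s : psdmx A -> psdmx (blk A s).
Proof. exact: psdmx_conj. Qed.

Lemma lemx_blk k d (A : 'M[C]_(k * d)) (c : C) (sigma : 'M[C]_d) s :
  lemx A (c *: ((1%:M : 'M[C]_k) *t sigma)) -> lemx (blk A s) (c *: sigma).
Proof.
move=> /(@psdmx_blk _ _ _ s); rewrite blkB /lemx.
suff -> : blk (c *: (1%:M *t sigma)) s = c *: sigma by [].
rewrite /blk -scalemxAr -scalemxAl -/(blk _ _) -[1%:M]scale1r scalar_tensE scale1r.
by rewrite (blk_diag (fun=> sigma)).
Qed.

Lemma trR_hashed k nX d (f : {ffun 'I_nX -> 'I_k}) (V : 'M[C]_(k * d))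
    (rhoE : 'I_nX -> 'M[C]_d) (c : C) (sigma : 'M[C]_d) :
  trR (V *m (hashed_state f rhoE - (c *: (1%:M : 'M[C]_k)) *t sigma)) =
  \sum_s trR (blk V s *m (\sum_(x | f x == s) rhoE x - c *: sigma)).
Proof.
rewrite scalar_tensE /hashed_state scaler_sumr -sumrB mulmx_sumr trR_sum.
apply: eq_bigr => s _; rewrite delta_tensE -trR_blk; congr (trR (_ *m _)).
by rewrite mulmxBr mulmxBl -scalemxAr -scalemxAl.
Qed.

(** Heisenberg picture of hashing: summing blocks over the fibres of [f] is dual to placing
    [V (f x)] at position [x]. *)
Lemma trR_diag_mul k nX d (f : 'I_nX -> 'I_k) (V : 'I_k -> 'M[C]_d)
    (X : 'M[C]_(nX * d)) :
  trR ((\sum_x adjmx (emb d x) *m V (f x) *m emb d x) *m X) =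
  \sum_s trR (V s *m \sum_(x | f x == s) blk X x).
Proof.
rewrite mulmx_suml trR_sum (partition_big f xpredT)//=; apply: eq_bigr => s _.
rewrite mulmx_sumr trR_sum; apply: eq_bigr => x /eqP ->.
by rewrite /blk -!mulmxA trR_mulC !mulmxA.
Qed.

(** Here [b] is the cost of replacing rho by tau, [t] the trace of tau and [F] the fidelity.
    Bounding [b] and [1 - t] jointly keeps the total at [2 * eps]. *)
Lemma smoothing_le (b t F eps : R) : 0 <= eps -> 0 <= t -> t <= 1 ->
  b ^+ 2 <= (1 + t) ^+ 2 - 4 * F ^+ 2 -> Num.sqrt (1 - F ^+ 2) <= eps ->
  b + (1 - t) <= 2 * eps.
Proof.
move=> e0 t0 t1 bF sF; have eF : 1 - F ^+ 2 <= eps ^+ 2.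
  have [h|h] := leP 0 (1 - F ^+ 2); last by have := sqr_ge0 eps; lra.
  by rewrite -(sqr_sqrtr h) ler_pXn2r ?nnegrE ?sqrtr_ge0.
have b2 : b ^+ 2 <= (1 + t) ^+ 2 by have := sqr_ge0 F; lra.
have b1 : b <= 1 + t.
  apply: le_trans (ler_norm b) _.
  by rewrite -(@ler_pXn2r _ 2) ?nnegrE ?addr_ge0// real_normK ?num_real.
have [e1|e1] := leP 1 eps; first by lra.
have h : (1 - t) ^+ 2 <= 4 * eps ^+ 2 by have := sqr_ge0 b; nra.
have h2 : 0 <= 2 * eps - (1 - t).
  rewrite subr_ge0 -(@ler_pXn2r _ 2) ?nnegrE ?subr_ge0 ?mulr_ge0// exprMn.
  by apply: le_trans h _; rewrite -natrX.
rewrite -lerBrDr; apply: le_trans (ler_norm b) _.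
(* With [F^2] bounded below by [1 - eps^2], the gap between the squares is at least
   [4 (1 - eps) (1 - t)]. *)
rewrite -(@ler_pXn2r _ 2) ?nnegrE// real_normK ?num_real//; nra.
Qed.

Lemma dist_unif_le k d (l : R) (rho : 'M[C]_(k * d)) (sigma : 'M[C]_d) :
  is_state sigma ->
  dist_unif l rho <=
    trnorm (rho - (toC (2 `^ (- l)) *: (1%:M : 'M[C]_k)) *t sigma) / 2.
Proof.
move=> ss; apply: ge_inf; last by exists sigma.
by exists 0 => _ [s _ <-]; rewrite divr_ge0 ?trnorm_ge0.
Qed.

(** * The bound for one smoothing state and one [lam] *)

Section Bound.
Variables (nX nS dE : nat) (F : {set {ffun 'I_nX -> 'I_nS}}).
Variables (rhoE : 'I_nX -> 'M[C]_dE) (rt : 'M[C]_(nX * dE)) (sigma : 'M[C]_dE).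
Variables (l lam eps : R).
Hypothesis nSl : nS%:R = 2 `^ l.
Hypothesis prho : forall x, psdmx (rhoE x).
Hypothesis trho : \sum_(x < nX) \tr (rhoE x) = 1.
Hypothesis srt : is_substate rt.
Hypothesis drt : purified_dist (cq_state rhoE) rt <= eps.
Hypothesis eps0 : 0 <= eps.
Hypothesis ssigma : is_state sigma.
Hypothesis lrt : lemx rt (toC (2 `^ (- lam)) *: ((1%:M : 'M[C]_nX) *t sigma)).

Let tauE := \sum_x blk rt x.
(* Completing the marginal of rt with a multiple of sigma, rather than
   normalising it, is what gives an additive error eps instead of 2 eps. *)
Let sigma' := tauE + toC (1 - trR rt) *: sigma.

Lemma psd_cq : psdmx (cq_state rhoE).
Proof.
rewrite cq_stateE; apply: psdmx_sum => x.
by have := psdmx_conj (adjmx (emb dE x)) (prho x); rewrite adjmxK.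
Qed.

Lemma trR_cq : trR (cq_state rhoE) = 1.
Proof.
rewrite -sum_trR_blk cq_stateE; under eq_bigr => x _ do rewrite blk_diag.
rewrite -trR_sum /trR; have -> : \tr (\sum_x rhoE x) = 1 by rewrite raddf_sum.
by [].
Qed.

Lemma trR_sigma : trR sigma = 1.
Proof. by have [_ s1] := ssigma; rewrite /trR s1. Qed.

Lemma sigma'_state : is_state sigma'.
Proof.
have [prt trt] := srt; have [ps _] := ssigma.
have p' : psdmx sigma'.
  apply: psdmxD; first by apply: psdmx_sum => x; exact: psdmx_blk.
  by apply: psdmxZ; rewrite // subr_ge0.
split=> //; rewrite psdmx_tr// trRD trRZ trR_sum sum_trR_blk trR_sigma.
by rewrite mulr1 addrC subrK.
Qed.

Lemma hashed_trnorm_le (f : {ffun 'I_nX -> 'I_nS}) (V : 'M[C]_(nS * dE)) :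
  contraction V ->
  trR (V *m (hashed_state f rhoE -
             (toC (2 `^ (- l)) *: (1%:M : 'M[C]_nS)) *t sigma')) <=
  2 * eps + `|\sum_s trR (blk V s *m
      (\sum_(x | f x == s) blk rt x - toC nS%:R^-1 *: tauE))|.
Proof.
move=> cV; have [prt trt] := srt; have [ps _] := ssigma.
rewrite trR_hashed powRN -nSl; set k := toC _.
have nS0 : 0 < nS%:R :> R by rewrite nSl powR_gt0.
pose W := \sum_x adjmx (emb dE x) *m blk V (f x) *m emb dE x.
have cW : contraction W.
  by apply: (diag_contraction (V := fun x => blk V (f x))) => x; exact: blk_contraction.
have bE x : blk (cq_state rhoE - rt) x = rhoE x - blk rt x.
  by rewrite blkB cq_stateE blk_diag.
(* Three contributions: smoothing, hashing of [rt], and the part of [sigma'] that completes the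
   trace. *)
have -> : \sum_s trR (blk V s *m (\sum_(x | f x == s) rhoE x - k *: sigma')) =
    trR (W *m (cq_state rhoE - rt))
    + \sum_s trR (blk V s *m (\sum_(x | f x == s) blk rt x - k *: tauE))
    - nS%:R^-1 * (1 - trR rt) * \sum_s trR (blk V s *m sigma).
  rewrite (trR_diag_mul f (blk V)) mulr_sumr -sumrN -!big_split; apply: eq_bigr => s _ /=.
  have -> : \sum_(x | f x == s) blk (cq_state rhoE - rt) x =
      \sum_(x | f x == s) rhoE x - \sum_(x | f x == s) blk rt x.
    by rewrite -sumrB; apply: eq_bigr => x _; exact: bE.
  rewrite -trRZ scalemxAr -[- trR (_ *m _)]trRN -!trRD -mulmxN -!mulmxDr; congr (trR (_ *m _)).
  rewrite /sigma' scalerDr scalerA -toCM addrA subrK opprD addrA.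
  by [].
(* Each of the [nS] blocks contributes at most [trR sigma = 1] in absolute value, which the factor
   [1/nS] compensates. *)
have h3 : - (nS%:R^-1 * (1 - trR rt) * \sum_s trR (blk V s *m sigma)) <= 1 - trR rt.
  apply: (@le_trans _ _ (nS%:R^-1 * (1 - trR rt) * nS%:R)); last first.
    by rewrite mulrAC mulVf ?mul1r// lt0r_neq0.
  rewrite -mulrN ler_wpM2l ?mulr_ge0 ?invr_ge0 ?subr_ge0//.
  have -> : nS%:R = \sum_(s < nS) 1 :> R by rewrite sumr_const card_ord.
  rewrite -sumrN; apply: ler_sum => s _; apply: le_trans (ler_norm _) _.
  rewrite normrN -trR_sigma.
  by apply: contraction_psd => //; exact: blk_contraction.
have h12 : trR (W *m (cq_state rhoE - rt)) + (1 - trR rt) <= 2 * eps.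
  apply: (@smoothing_le _ _ (trnorm (sqrtm (cq_state rhoE) *m sqrtm rt))) => //.
  - by rewrite psdmx_rip// rip_ge0.
  - rewrite -{1}trR_cq; exact: fuchs_van_de_graaf psd_cq prt cW.
  (* As rho has trace 1, the correction term of the generalised fidelity vanishes. *)
  - by move: drt; rewrite /purified_dist /gen_fidelity trR_cq subrr mul0r sqrtr0 addr0.
have := lerD (le_trans (lerD (lexx _) h3) h12) (ler_norm
  (\sum_s trR (blk V s *m (\sum_(x | f x == s) blk rt x - k *: tauE)))).
by rewrite -/k addrAC.
Qed.

Lemma averaged_dist_le (P : {ffun 'I_nX -> 'I_nS} -> R) (alpha beta : R) :
  two_universal R F -> #|F|%:R = 2 `^ alpha ->
  (forall f, f \in F -> 0 <= P f) -> \sum_(f in F) P f = 1 ->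
  (forall f, f \in F -> P f <= 2 `^ (- beta)) ->
  \sum_(f in F) P f * dist_unif l (hashed_state f rhoE) <=
    2 `^ (alpha - beta) / 2 * 2 `^ (- ((lam - l) / 2)) + eps.
Proof.
move=> uF cF P0 P1 Pb; have [prt trt] := srt; have [ps _] := ssigma.
have nS0 : (0 < nS)%N by rewrite -(ltr0n R) nSl powR_gt0.
have F0 : (0 < #|F|)%N by rewrite -(ltr0n R) cF powR_gt0.
have /choice [V hV] : forall f : {ffun 'I_nX -> 'I_nS}, exists V,
    contraction V /\ trR (V *m (hashed_state f rhoE -
             (toC (2 `^ (- l)) *: (1%:M : 'M[C]_nS)) *t sigma')) =
    trnorm (hashed_state f rhoE -
             (toC (2 `^ (- l)) *: (1%:M : 'M[C]_nS)) *t sigma').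
  move=> f; have [V [N [h1 h2]]] := trnorm_polar (hashed_state f rhoE -
             (toC (2 `^ (- l)) *: (1%:M : 'M[C]_nS)) *t sigma').
  by exists V; split=> //; exact: complemented_contraction h2.
pose a f := `|\sum_s trR (blk (V f) s *m
      (\sum_(x | f x == s) blk rt x - toC nS%:R^-1 *: tauE))|.
have leD (f : {ffun 'I_nX -> 'I_nS}) :
    dist_unif l (hashed_state f rhoE) <= eps + a f / 2.
  apply: le_trans (dist_unif_le _ _ sigma'_state) _.
  have [cV <-] := hV f; have := hashed_trnorm_le f cV; rewrite -/(a f); lra.
have a_le : \sum_(f in F) a f <= 2 `^ alpha * 2 `^ (- ((lam - l) / 2)).
  apply: le_trans (leftover_hash (c := 2 `^ (- lam))
    (tau := blk rt) (V := fun f => blk (V f)) nS0 F0 uF ps trR_sigma _ _ _) _.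
  - by move=> x; exact: psdmx_blk.
  - by move=> x; exact: lemx_blk.
  - by move=> f s; apply: blk_contraction; have [] := hV f.
  rewrite cF ler_wpM2l ?powR_ge0// sum_trR_blk nSl.
  rewrite -(@ler_pXn2r _ 2) ?nnegrE ?sqrtr_ge0 ?powR_ge0//.
  have t0 : 0 <= trR rt by rewrite psdmx_rip// rip_ge0.
  rewrite sqr_sqrtr ?mulr_ge0 ?powR_ge0// expr2 -powRD; last first.
    by rewrite pnatr_eq0 implybT.
  have -> : - ((lam - l) / 2) + - ((lam - l) / 2) = l + - lam by lra.
  rewrite powRD ?pnatr_eq0 ?implybT// ler_wpM2l ?powR_ge0//.
  by rewrite ler_piMr ?powR_ge0.
(* Only the hashing term uses the pointwise bound on [P]; the smoothing term keeps [P f], so that it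
   averages to exactly [eps]. *)
apply: (@le_trans _ _ (\sum_(f in F) (P f * eps + 2 `^ (- beta) * (a f / 2)))).
  apply: ler_sum => f fF; apply: le_trans (ler_wpM2l (P0 _ fF) (leD f)) _.
  by rewrite mulrDr lerD2l ler_wpM2r ?divr_ge0 ?normr_ge0// Pb.
rewrite big_split /= -mulr_suml P1 mul1r -mulr_sumr -mulr_suml addrC lerD2r.
rewrite powRD ?pnatr_eq0 ?implybT//.
have := ler_wpM2l (powR_ge0 2 (- beta)) a_le.
move: (2 `^ (- beta)) (2 `^ alpha) (2 `^ (- ((lam - l) / 2))) (\sum_(i in F) a i).
by move=> p q r u; lra.
Qed.
End Bound.
End Hashing.

(** * Passage to the smooth min-entropy *)

Theorem theorem1 (R : realType) (nX nS dE : nat) (l alpha beta eps : R)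
  (F : {set {ffun 'I_nX -> 'I_nS}}) (P : {ffun 'I_nX -> 'I_nS} -> R)
  (rhoE : 'I_nX -> 'M[R[i]]_dE) :
  nS%:R = 2 `^ l ->
  two_universal R F ->
  #|F|%:R = 2 `^ alpha ->
  (forall f, f \in F -> 0 <= P f) ->
  \sum_(f in F) P f = 1 ->
  (forall f, f \in F -> P f <= 2 `^ (- beta)) ->
  (forall x, psdmx (rhoE x)) ->
  \sum_(x < nX) \tr (rhoE x) = 1 ->
  0 <= eps ->
  ((\sum_(f in F) P f * dist_unif l (hashed_state f rhoE))%:E <=
    ((2 `^ (alpha - beta)) / 2)%:E *
      pow2e (- ((hmin_smooth eps (cq_state rhoE) - l%:E) * (2^-1)%:E))
    + eps%:E)%E.
Proof.
move=> nSl uF cF P0 P1 Pb prho trho eps0.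
set L := \sum_(f in F) _; set K := 2 `^ (alpha - beta) / 2.
have K0 : 0 < K by rewrite divr_gt0 ?powR_gt0.
have bound rt lam sigma : is_substate rt ->
    purified_dist (cq_state rhoE) rt <= eps -> is_state sigma ->
    lemx rt (toC (2 `^ (- lam)) *: ((1%:M : 'M[R[i]]_nX) *t sigma)) ->
    L <= K * 2 `^ (- ((lam - l) / 2)) + eps.
  by move=> srt drt ss lrt; apply: (averaged_dist_le nSl prho trho srt drt eps0 ss lrt).
set H := hmin_smooth _ _.
(* If [L <= eps], nonnegativity of the first term suffices for every value of [H]; otherwise the
   logarithm of [(L - eps) / K] makes sense. *)
have [Le|eL] := leP L eps.
  apply: (@le_trans _ _ eps%:E); first by rewrite lee_fin.
  rewrite -[leLHS]add0e leeD2r// mule_ge0 ?lee_fin ?(ltW K0)//.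
  by case: (- _)%E => [r| |] //=; rewrite ?lee_fin ?powR_ge0.
have ln2 : 0 < ln (2 : R) by rewrite ln_gt0// ltr1n.
(* [B] is the entropy at which the claimed bound becomes an equality. The claim reduces to [H <= B],
   which is checked on each member of the suprema, whether or not they are attained. *)
pose B := l - 2 * (ln ((L - eps) / K) / ln 2).
have pB : 2 `^ (- ((B - l) / 2)) = (L - eps) / K.
  have -> : - ((B - l) / 2) = ln ((L - eps) / K) / ln 2 by rewrite /B; lra.
  rewrite /powR pnatr_eq0 /= divfK ?gt_eqF// lnK// posrE.
  by rewrite divr_gt0 ?subr_gt0.
have HB : (H <= B%:E)%E.
  apply: ge_ereal_sup => _ [rt [srt drt] <-].
  apply: ge_ereal_sup => _ [lam [sigma [ss lrt]] <-].
  rewrite lee_fin leNgt; apply/negP => Blam.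
  have := bound _ _ _ srt drt ss lrt; rewrite -lerBlDr leNgt => /negP; apply.
  rewrite -ltr_pdivlMl// [ltRHS]mulrC -pB.
  rewrite /powR pnatr_eq0 /= ltr_expR ltr_pM2r//; lra.
case: H HB => [h| |]//= hB.
  rewrite -EFinM lee_fin -lerBlDr -ler_pdivrMl// [leLHS]mulrC -pB.
  rewrite /powR pnatr_eq0 /= ler_expR ler_pM2r//.
  by move: hB; rewrite lee_fin; lra.
(* The value [+oo] is excluded by [H <= B]; at [-oo] the right-hand side is [+oo]. *)
rewrite mulNyr sgrV gtr0_sg// mul1e /= gt0_muley ?lte_fin// addye//.
by rewrite leey.
Qed.
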